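(* Let $\mathcal{M}$ be a discretely ordered ring with underlying set $M$, let $\mathcal{M}^+$ be its nonnegative part, and let $\mathrm{F}(\mathcal{M})$ be its (ordered) fraction field. Then the following are equivalent: (1) $\mathcal{M}$ is an integer part of $\mathrm{F}(\mathcal{M})$; (2) every fraction $m'/m$ with $m',m\in M$ and $0<m$ has an integer part in $M$; (3) $\mathcal{M}\models\mathrm{IPR}(\{m(x) : m\in M\})$, where $m(x)=m\cdot x$; ( *3) for all $n,k\in \mathcal{M}^+$ with $k\neq 0$ there exist $n',l\in \mathcal{M}^+$ with $0\leq l<k$ and $n=n'\cdot k+l$; (4) $\mathcal{M}^+\models\mathrm{IOpenLin}$.
   Context: A discretely ordered ring is a structure $\langle R,0,1,+,-,\cdot,\leq\rangle$ such that $\langle R,0,1,+,-,\cdot\rangle$ is a commutative ring, $\leq$ is a linear ordering on $R$ such that $1$ is the least positive element, and for all $a,b,c\in R$: $a\leq b\to a+c\leq b+c$, and $0\leq a,b\to 0\leq a\cdot b$. Its nonnegative part $\mathcal{M}^+$, in the language $\langle 0,1,+,\cdot,\leq\rangle$ (without $-$), is called a discretely ordered semiring. $\mathrm{F}(\mathcal{M})$ denotes the fraction field of $\mathcal{M}$ with the ordering extending that of $\mathcal{M}$. A discretely ordered subring $I$ of an ordered ring $\mathcal{R}$ is an integer part of $\mathcal{R}$ if for every $r\in\mathcal{R}$ there is $i\in I$ with $r-1<i\leq r$. An element $m\in M$ is called the integer part of $r$ if $r-1<m\leq r$. For a definable unary function $f$ on $\mathcal{M}$, $\mathrm{IPR}(f)$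 is the formula (with $a,b,y$ universally quantified over $M$, and $x$ ranging over $M$) $$(a<b \wedge f(a)\leq y<f(b))\to(\exists x)(a\leq x<b\wedge f(x)\leq y<f(x+1)).$$ For a set $\mathcal{F}$ of definable unary functions, $\mathrm{IPR}(\mathcal{F})$ is the scheme $\{\mathrm{IPR}(f): f\in\mathcal{F}\}$. Robinson arithmetic $\mathrm{Q}$ is the theory in the language $\langle 0,1,+,\cdot,\leq\rangle$ with axioms $x+1\neq 0$; $x+1=y+1\to x=y$; $x\neq 0\to(\exists y)(x=y+1)$; $x+0=x$; $x+(y+1)=(x+y)+1$; $x\cdot 0=0$; $x\cdot(y+1)=x\cdot y+x$; $x\leq y\leftrightarrow(\exists z)(z+x=y)$. These hold in every discretely ordered semiring. $\mathrm{IOpenLin}$ (open linear induction) is the extension of $\mathrm{Q}$ by the induction scheme $$\big(\varphi(0,\overline{y})\wedge(\forall x)(\varphi(x,\overline{y})\to\varphi(x+1,\overline{y}))\big)\to(\forall x)\varphi(x,\overline{y})$$ (universally closed over the parameters $\overline{y}$) for all quantifier-free formulas $\varphi(x,\overline{y})$ with distinguished variable $x$ that are linear, meaning that in every occurrence of $\cdot$ in $\varphi$ at least one of the two factors is one of the variables $y_i$. *)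

(* Defs.v *)
From HB Require Import structures.
From mathcomp Require Import all_boot all_order all_algebra generic_quotient.

Set Implicit Arguments.
Unset Strict Implicit.
Unset Printing Implicit Defensive.

Import Order.TTheory GRing.Theory Num.Theory.
Local Open Scope ring_scope.

HB.mixin Record RealDomain_isDiscrete R of Num.RealDomain R := {
  gt0_ge1 : forall x : R, 0 < x -> 1 <= x
}.

#[short(type="discOrdRingType")]
HB.structure Definition DiscOrdRing :=
  {R of RealDomain_isDiscrete R & Num.RealDomain R}.

(* A [realDomainType] carries more than an ordered commutative ring: no zero
   divisors, decidable units, a norm. In the discrete case all of this follows
   from the ring and order axioms, as this factory shows. *)
HB.factory Record ComPzRing_isDiscOrd R of GRing.ComPzRing R := {
  le : rel R;
  le_refl : reflexive le;
  le_anti : antisymmetric le;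
  le_trans : transitive le;
  le_total : total le;
  le_add2r : forall c a b, le a b -> le (a + c) (b + c);
  le0_mul : forall a b, le 0 a -> le 0 b -> le 0 (a * b);
  lt01 : (1 != 0 :> R) && le 0 1;
  least1 : forall a, (a != 0) && le 0 a -> le 1 a
}.

HB.builders Context R of ComPzRing_isDiscOrd R.

Fact oner_neq0 : 1 != 0 :> R. Proof. by case/andP: lt01. Qed.
HB.instance Definition _ := GRing.PzSemiRing_isNonZero.Build R oner_neq0.

Fact sub_ge0 x y : le 0 (y - x) = le x y.
Proof.
apply/idP/idP => [/(le_add2r x)|/(le_add2r (- x))]; last by rewrite subrr.
by rewrite add0r subrK.
Qed.

Fact leN0 x : le x 0 -> le 0 (- x).
Proof. by rewrite -(sub_ge0 x) sub0r. Qed.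

Fact mul_gt0_ge a b : a != 0 -> le 0 a -> b != 0 -> le 0 b -> le b (a * b).
Proof.
move=> an0 a0 bn0 b0; rewrite -sub_ge0 -{2}[b]mul1r -mulrBl le0_mul //.
by rewrite sub_ge0 least1 ?an0.
Qed.

Fact le0_0 x : le 0 x -> le x 0 -> x = 0.
Proof. by move=> x0 x0'; apply: le_anti; rewrite x0 x0'. Qed.

Fact abs_ge0 x : exists2 y, le 0 y & x = y \/ x = - y.
Proof.
case/orP: (le_total 0 x) => [|/leN0] x0; first by exists x; [|left].
by exists (- x); [|right; rewrite opprK].
Qed.

Fact pos_integral a b : le 0 a -> le 0 b -> a * b = 0 -> (a == 0) || (b == 0).
Proof.
move=> a0 b0 ab0; case: eqVneq => //= an0; apply: contraTT isT => bn0.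
have := mul_gt0_ge an0 a0 bn0 b0; rewrite ab0 => b0'.
by rewrite (le0_0 b0 b0') eqxx in bn0.
Qed.

Fact integral (a b : R) : a * b = 0 -> (a == 0) || (b == 0).
Proof.
have [c c0 ac] := abs_ge0 a; have [d d0 bd] := abs_ge0 b => ab0.
have {ab0} cd0 : c * d = 0.
  by move: ab0; case: ac => ->; case: bd => ->;
    rewrite ?mulrN ?mulNr ?opprK // => /eqP; rewrite oppr_eq0 => /eqP.
by case: ac bd (pos_integral c0 d0 cd0) => -> [] ->; rewrite ?oppr_eq0.
Qed.

Definition dunit : {pred R} := [pred x | (x == 1) || (x == - 1)].

Fact pos_unit a b : le 0 a -> le 0 b -> b * a = 1 -> a = 1.
Proof.
move=> a0 b0 ba1.
have an0 : a != 0 by apply: contra_eq_neq ba1 => ->; rewrite mulr0 eq_sym oner_neq0.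
have bn0 : b != 0 by apply: contra_eq_neq ba1 => ->; rewrite mul0r eq_sym oner_neq0.
apply: le_anti; rewrite least1 ?an0 // andbT.
by rewrite -ba1 mul_gt0_ge.
Qed.

Fact dunitPl x y : y * x = 1 -> dunit x.
Proof.
have [c c0 xc] := abs_ge0 x; have [d d0 yd] := abs_ge0 y => yx1.
rewrite /dunit /=.
have : d * c = 1 \/ d * c = - 1.
  by case: xc yd yx1 => -> [] ->; rewrite ?mulrN ?mulNr ?opprK => <-;
    rewrite ?opprK; auto.
case=> [/(pos_unit c0 d0) c1|dc1].
  by case: xc => ->; rewrite c1 eqxx ?orbT.
have : le 0 (- 1 : R) by rewrite -dc1 le0_mul.
rewrite -[- 1]sub0r sub_ge0 => /le0_0; case/andP: lt01 => n01 -> /(_ isT) e.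
by rewrite e eqxx in n01.
Qed.

Fact dmulVx : {in dunit, left_inverse 1 id (@GRing.mul R)}.
Proof. by move=> x /orP[] /eqP ->; rewrite ?mulr1 // mulrNN mulr1. Qed.

Fact dinv_out : {in [predC dunit], (@id R) =1 id}. Proof. by []. Qed.

HB.instance Definition _ :=
  GRing.ComNzRing_hasMulInverse.Build R dmulVx dunitPl dinv_out.
HB.instance Definition _ := GRing.ComUnitRing_isIntegral.Build R integral.

Definition dlt : rel R := fun x y => (y != x) && le x y.
Definition dnorm (x : R) := if le 0 x then x else - x.

Fact le0_add x y : le 0 x -> le 0 y -> le 0 (x + y).
Proof.
by move=> x0 y0; apply: (le_trans y0); have := le_add2r y x0; rewrite add0r.
Qed.
Fact dnormN x : dnorm (- x) = dnorm x.
Proof.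
rewrite /dnorm; case: ifPn => Nx; case: ifPn => x0; rewrite ?opprK //.
  rewrite (_ : x = 0) ?oppr0 //; apply: le0_0 => //.
  by rewrite -sub_ge0 sub0r.
by case/orP: (le_total 0 x) (x0) => [->//|/leN0]; rewrite (negPf Nx).
Qed.
Fact dge0_norm x : le 0 x -> dnorm x = x.
Proof. by rewrite /dnorm => ->. Qed.

HB.instance Definition _ := Num.IntegralDomain_isLeReal.Build R
  le0_add le0_mul le0_0 sub_ge0 (fun x => le_total 0 x) dnormN dge0_norm
  (fun x y => erefl (dlt x y)).

Fact gt0_ge1 (x : R) : 0 < x -> 1 <= x.
Proof. exact: least1. Qed.
HB.instance Definition _ := RealDomain_isDiscrete.Build R gt0_ge1.
HB.end.

Notation "x %:F" := (@FracField.tofrac _ x) : ring_scope.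

Section OrderedFractions.
Variable R : realDomainType.
Local Open Scope quotient_scope.
Implicit Types x y z : {fraction R}.

Let num x : R := \n_(repr x).
Let den x : R := \d_(repr x).

Let den_neq0 x : den x != 0. Proof. exact: denom_ratioP. Qed.

Let fracE x : x = (num x)%:F / (den x)%:F.
Proof.
have dF : (den x)%:F != 0 :> {fraction R} by rewrite tofrac_eq0.
apply: (mulIf dF); rewrite mulfVK // -{1}[x]reprK /num /den.
move: (repr x) (denom_ratioP (repr x)) => r rd.
unlock FracField.tofrac.
rewrite -[LHS]FracField.pi_mul /FracField.mulf; apply/eqmodP => /=.
by rewrite FracField.equivfE !numden_Ratio ?oner_eq0 ?mulr1 // mulrC.
Qed.

(* a/b >= 0 iff a * b >= 0, for any sign of b. *)
Definition frac_ge0 x := 0 <= num x * den x.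
Definition frac_le x y := frac_ge0 (y - x).
Definition frac_lt x y := (y != x) && frac_le x y.
Definition frac_norm x := if frac_ge0 x then x else - x.

Let frac_ge0E (a b : R) : b != 0 -> frac_ge0 (a%:F / b%:F) = (0 <= a * b).
Proof.
move=> b0; rewrite /frac_ge0; set z := _ / _.
have bF : b%:F != 0 :> {fraction R} by rewrite tofrac_eq0.
have dF : (den z)%:F != 0 :> {fraction R} by rewrite tofrac_eq0.
have /eqP := fracE z; rewrite {1}/z eqr_div // -!tofracM tofrac_eq => /eqP nd.
have b2 : 0 < b * b by rewrite -expr2 exprn_even_gt0.
have d2 : 0 < den z * den z by rewrite -expr2 exprn_even_gt0 // den_neq0.
rewrite -(pmulr_lge0 _ b2) -[RHS](pmulr_lge0 _ d2).
by congr (0 <= _); rewrite mulrACA -nd [RHS]mulrACA [den z * b]mulrC.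
Qed.

Let frac_case x : exists a b : R, b != 0 /\ x = a%:F / b%:F.
Proof. by exists (num x), (den x); rewrite den_neq0 -fracE. Qed.

Let frac_pcase x : exists a b : R, 0 < b /\ x = a%:F / b%:F.
Proof.
have [a [b [b0 ->]]] := frac_case x.
case: (ltrgt0P b) b0 => // b0 _; first by exists a, b.
exists (- a), (- b); rewrite oppr_gt0; split=> //.
by rewrite !rmorphN invrN mulrNN.
Qed.

Let frac_ge0P (a b : R) : 0 < b -> frac_ge0 (a%:F / b%:F) = (0 <= a).
Proof. by move=> b0; rewrite frac_ge0E ?gt_eqF // pmulr_lge0. Qed.

Let le0E x : frac_le 0 x = frac_ge0 x. Proof. by rewrite /frac_le subr0. Qed.
Let lex0 x : frac_le x 0 = frac_ge0 (- x). Proof. by rewrite /frac_le sub0r. Qed.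

Let frac_le0_add x y : frac_le 0 x -> frac_le 0 y -> frac_le 0 (x + y).
Proof.
rewrite !le0E.
have [a [b [b0 ->]]] := frac_pcase x; have [c [d [d0 ->]]] := frac_pcase y.
rewrite !frac_ge0P // => a0 c0.
have bF : b%:F != 0 :> {fraction R} by rewrite tofrac_eq0 gt_eqF.
have dF : d%:F != 0 :> {fraction R} by rewrite tofrac_eq0 gt_eqF.
rewrite addf_div // -!tofracM -tofracD frac_ge0P ?mulr_gt0 //.
by rewrite addr_ge0 // mulr_ge0 // ltW.
Qed.

Let frac_le0_mul x y : frac_le 0 x -> frac_le 0 y -> frac_le 0 (x * y).
Proof.
rewrite !le0E.
have [a [b [b0 ->]]] := frac_pcase x; have [c [d [d0 ->]]] := frac_pcase y.
rewrite !frac_ge0P // => a0 c0.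
by rewrite mulf_div -!tofracM frac_ge0P ?mulr_gt0 // mulr_ge0.
Qed.

Let frac_le0_anti x : frac_le 0 x -> frac_le x 0 -> x = 0.
Proof.
rewrite le0E lex0; have [a [b [b0 ->]]] := frac_pcase x.
rewrite -mulNr -tofracN !frac_ge0P // oppr_ge0 => a0 a0'.
by rewrite (@le_anti _ _ a 0) ?a0 ?a0' // tofrac0 mul0r.
Qed.

Let frac_sub_ge0 x y : frac_le 0 (y - x) = frac_le x y.
Proof. by rewrite le0E. Qed.

Let frac_le0_total x : frac_le 0 x || frac_le x 0.
Proof.
rewrite le0E lex0; have [a [b [b0 ->]]] := frac_pcase x.
by rewrite -mulNr -tofracN !frac_ge0P // oppr_ge0 le_total.
Qed.

Let frac_normN x : frac_norm (- x) = frac_norm x.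
Proof.
have := frac_le0_total x; have := @frac_le0_anti x.
rewrite le0E lex0 /frac_norm.
case: (frac_ge0 x); case: (frac_ge0 (- x)) => //; rewrite ?opprK //.
by move=> ->; rewrite ?oppr0.
Qed.

Let frac_ge0_norm x : frac_le 0 x -> frac_norm x = x.
Proof. by rewrite le0E /frac_norm => ->. Qed.

HB.instance Definition _ := Num.IntegralDomain_isLeReal.Build {fraction R}
  frac_le0_add frac_le0_mul frac_le0_anti frac_sub_ge0 frac_le0_total
  frac_normN frac_ge0_norm (fun x y => erefl (frac_lt x y)).

(* The instance is the field ordering extending that of R: see [ler_tofrac]. *)
Lemma frac_div_ge0 (a b : R) : 0 < b -> (0 <= a%:F / b%:F) = (0 <= a).
Proof. by move=> b0; rewrite -(frac_ge0P a b0) -le0E. Qed.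

Lemma fracP x : exists a b : R, 0 < b /\ x = a%:F / b%:F.
Proof. exact: frac_pcase. Qed.

Lemma ler_tofrac (a b : R) : (a%:F <= b%:F :> {fraction R}) = (a <= b).
Proof.
by rewrite -subr_ge0 -tofracB -[X in 0 <= X]divr1 -tofrac1 frac_div_ge0 // subr_ge0.
Qed.

Lemma ltr_tofrac (a b : R) : (a%:F < b%:F :> {fraction R}) = (a < b).
Proof. by rewrite !lt_neqAle ler_tofrac tofrac_eq. Qed.

End OrderedFractions.

Definition int_part_of (R : numDomainType) (m r : R) := r - 1 < m <= r.

Definition disc_ord_subring (R : numDomainType) (I : R -> Prop) :=
  [/\ I 1,
      forall x y, I x -> I y -> I (x - y),
      forall x y, I x -> I y -> I (x * y) &
      forall x, I x -> 0 < x -> 1 <= x].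

Definition integer_part (R : numDomainType) (I : R -> Prop) :=
  disc_ord_subring I /\ forall r, exists2 i, I i & int_part_of i r.

(* Semantic: [f] ranges over all unary functions on M, definable or not. *)
Definition IPR (M : numDomainType) (f : M -> M) : Prop :=
  forall a b y : M, a < b -> f a <= y < f b ->
    exists x : M, (a <= x < b) /\ (f x <= y < f (x + 1)).

Definition IPRs (M : numDomainType) (F : (M -> M) -> Prop) : Prop :=
  forall f, F f -> IPR f.

Record nonneg (R : numDomainType) :=
  Nonneg { nonneg_val :> R; _ : nonneg_val \is Num.nneg }.

Section NonnegInstances.
Variable R : realDomainType.
HB.instance Definition _ := [isSub for @nonneg_val R].
HB.instance Definition _ := [Choice of nonneg R by <:].
HB.instance Definition _ := [SubChoice_isSubComNzSemiRing of nonneg R by <:].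
HB.instance Definition _ :=
  [SubChoice_isSubOrder of nonneg R by <: with ring_display].
End NonnegInstances.

Inductive term :=
  | Var of nat
  | Zero
  | One
  | Add of term & term
  | Mul of term & term.

Inductive formula :=
  | Eq of term & term
  | Le of term & term
  | Not of formula
  | And of formula & formula
  | Or of formula & formula
  | Imp of formula & formula
  | All of nat & formula
  | Ex of nat & formula.

Declare Scope arith_scope.
Delimit Scope arith_scope with A.
Bind Scope arith_scope with term formula.
Notation "0" := Zero : arith_scope.
Notation "1" := One : arith_scope.
Notation "s + t" := (Add s t) : arith_scope.
Notation "s * t" := (Mul s t) : arith_scope.
Notation "s == t" := (Eq s t) : arith_scope.
Notation "s != t" := (Not (Eq s t)) : arith_scope.
Notation "s <= t" := (Le s t) : arith_scope.
Notation "p /\ q" := (And p q) : arith_scope.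
Notation "p ==> q" := (Imp p q) : arith_scope.

Fixpoint open_formula (p : formula) : bool :=
  match p with
  | Eq _ _ | Le _ _ => true
  | Not q => open_formula q
  | And q r | Or q r | Imp q r => open_formula q && open_formula r
  | All _ _ | Ex _ _ => false
  end.

(* [t] is one of the parameters, i.e., a variable other than [x] *)
Definition is_param (x : nat) (t : term) : bool :=
  if t is Var y then y != x else false.

Fixpoint linear_term (x : nat) (t : term) : bool :=
  match t with
  | Var _ | Zero | One => true
  | Add s t => linear_term x s && linear_term x t
  | Mul s t =>
      [&& is_param x s || is_param x t, linear_term x s & linear_term x t]
  end.

(* [x] is the distinguished variable; all other variables are parameters. *)
Fixpoint linear_formula (x : nat) (p : formula) : bool :=
  match p with
  | Eq s t | Le s t => linear_term x s && linear_term x t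
  | Not q | All _ q | Ex _ q => linear_formula x q
  | And q r | Or q r | Imp q r => linear_formula x q && linear_formula x r
  end.

Fixpoint tsubst (x : nat) (u : term) (t : term) : term :=
  match t with
  | Var y => if y == x then u else Var y
  | Zero => Zero
  | One => One
  | Add s t => Add (tsubst x u s) (tsubst x u t)
  | Mul s t => Mul (tsubst x u s) (tsubst x u t)
  end.

(* Not capture-avoiding: only applied below to open formulas. *)
Fixpoint fsubst (x : nat) (u : term) (p : formula) : formula :=
  match p with
  | Eq s t => Eq (tsubst x u s) (tsubst x u t)
  | Le s t => Le (tsubst x u s) (tsubst x u t)
  | Not q => Not (fsubst x u q)
  | And q r => And (fsubst x u q) (fsubst x u r)
  | Or q r => Or (fsubst x u q) (fsubst x u r)
  | Imp q r => Imp (fsubst x u q) (fsubst x u r)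
  | All y q => All y (if y == x then q else fsubst x u q)
  | Ex y q => Ex y (if y == x then q else fsubst x u q)
  end.

Inductive robinsonQ : formula -> Prop :=
  | Q_succ_neq0 : robinsonQ (Var 0 + 1 != 0)
  | Q_succ_inj : robinsonQ ((Var 0 + 1 == Var 1 + 1) ==> (Var 0 == Var 1))
  | Q_pred : robinsonQ ((Var 0 != 0) ==> Ex 1 (Var 0 == Var 1 + 1))
  | Q_add0 : robinsonQ (Var 0 + 0 == Var 0)
  | Q_addS : robinsonQ (Var 0 + (Var 1 + 1) == (Var 0 + Var 1) + 1)
  | Q_mul0 : robinsonQ (Var 0 * 0 == 0)
  | Q_mulS : robinsonQ (Var 0 * (Var 1 + 1) == Var 0 * Var 1 + Var 0)
  | Q_le : robinsonQ
      (((Var 0 <= Var 1) ==> Ex 2 (Var 2 + Var 0 == Var 1)) /\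
       (Ex 2 (Var 2 + Var 0 == Var 1) ==> (Var 0 <= Var 1))).

Definition induction_axiom (x : nat) (p : formula) : formula :=
  ((fsubst x 0 p /\ All x (p ==> fsubst x (Var x + 1) p)) ==> All x p)%A.

Inductive IOpenLin : formula -> Prop :=
  | IOpenLin_Q p : robinsonQ p -> IOpenLin p
  | IOpenLin_induct x p : open_formula p -> linear_formula x p ->
      IOpenLin (induction_axiom x p).

Record arith_structure := ArithStructure {
  carrier : Type;
  azero : carrier;
  aone : carrier;
  aadd : carrier -> carrier -> carrier;
  amul : carrier -> carrier -> carrier;
  ale : carrier -> carrier -> Prop
}.

Section Satisfaction.
Variable S : arith_structure.

Fixpoint eval (v : nat -> carrier S) (t : term) : carrier S :=
  match t with
  | Var x => v x
  | Zero => azero S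
  | One => aone S
  | Add s t => aadd (eval v s) (eval v t)
  | Mul s t => amul (eval v s) (eval v t)
  end.

Fixpoint sat (v : nat -> carrier S) (p : formula) : Prop :=
  match p with
  | Eq s t => eval v s = eval v t
  | Le s t => ale (eval v s) (eval v t)
  | Not q => ~ sat v q
  | And q r => sat v q /\ sat v r
  | Or q r => sat v q \/ sat v r
  | Imp q r => sat v q -> sat v r
  | All x q => forall a, sat [eta v with x |-> a] q
  | Ex x q => exists a, sat [eta v with x |-> a] q
  end.

(* Quantifying over all valuations takes the universal closure of each axiom. *)
Definition models (T : formula -> Prop) : Prop :=
  forall p, T p -> forall v, sat v p.

End Satisfaction.

Definition nonneg_structure (R : realDomainType) : arith_structure :=
  {| carrier := nonneg R;
     azero := 0;
     aone := 1;
     aadd := fun x y => x + y;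
     amul := fun x y => x * y;
     ale := fun x y => (x <= y)%O |}.

(* Main.v *)
Require Import Defs.
From Stdlib Require Import Classical_Prop.
From mathcomp Require Import all_boot all_order all_algebra.
From mathcomp Require Import ring lra.

Set Implicit Arguments.
Unset Strict Implicit.
Unset Printing Implicit Defensive.

Import Order.TTheory GRing.Theory Num.Theory.
Local Open Scope ring_scope.

(** All five conditions say that Euclidean division is possible in [M], in the
    form [floor_division M]: for [0 < m], every [n] lies in an interval
    [m * q <= n < m * (q + 1)].  Clearing denominators ([int_part_fracE]), this
    is the existence of an integer part of [n / m], hence (1) and (2); it is
    also what IPR gives for the function [x |-> m * x] between [0] and [n + 1],
    hence (3); and it is division with remainder, hence the starred condition.
    That the last one speaks only of nonnegative numerators is harmless, since
    translating [n] by a multiple of [m] translates the quotient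
    ([floor_division_nonneg]).

    Linear induction yields division because it applies to [m * x <= n]: this
    holds at [0], fails at [n + 1], and so must fail at [x + 1] for some [x] at
    which it holds; such an [x] is the quotient ([floor_division_of_IOpenLin]).

    Conversely, with the parameters fixed, a linear atomic formula compares two
    affine functions of [x], that is, it gives the sign of one affine function
    [c * x + d].  In a field, if [c != 0], it changes only at [- d / c]; floor division
    provides a point of [M] that plays the same role ([affine_sign_change]).
    The truth value of a linear open formula therefore changes at finitely many
    points only ([linear_formula_breaks]).  Induction for such a predicate is an
    external induction over the finite list of points
    ([breaks_only_at_induction]): between two of them the truth value is
    constant, and each one is crossed by a single use of the induction step. *)

(** * Floor division *)

Lemma leD1 (M : discOrdRingType) (x y : M) : (x + 1 <= y) = (x < y).
Proof.
apply/idP/idP => [|xy]; first by apply: lt_le_trans; lra.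
by rewrite -lerBrDl gt0_ge1 // subr_gt0.
Qed.

Lemma int_part_fracE (M : realDomainType) (i n m : M) : 0 < m ->
  int_part_of (i%:F : {fraction M}) (n%:F / m%:F) = (m * i <= n < m * (i + 1)).
Proof.
move=> m0; have mF : 0 < m%:F :> {fraction M} by rewrite -tofrac0 ltr_tofrac.
rewrite /int_part_of andbC ltrBlDr ler_pdivlMr // ltr_pdivrMr //.
by rewrite -tofrac1 -tofracD -!tofracM ler_tofrac ltr_tofrac ![m * _]mulrC.
Qed.

Definition floor_division (M : numDomainType) : Prop :=
  forall n m : M, 0 < m -> exists q : M, m * q <= n < m * (q + 1).

(** Nonnegative numerators suffice: as [1 <= m], the translate [n + m * `|n|] is
    nonnegative, and its quotient exceeds that of [n] by [`|n|]. *)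
Lemma floor_division_nonneg (M : discOrdRingType) :
  (forall n m : M, 0 <= n -> 0 < m -> exists q : M, m * q <= n < m * (q + 1)) ->
  floor_division M.
Proof.
move=> H n m m0; have m1 := gt0_ge1 _ m0.
have [|q /andP[q1 q2]] := H (n + m * `|n|) m _ m0; last first.
  by exists (q - `|n|); apply/andP; split; lra.
have : 0 <= (m - 1) * `|n| by rewrite mulr_ge0 // subr_ge0.
have := ler_norm (- n); rewrite normrN; lra.
Qed.

Lemma floor_threshold (M : discOrdRingType) : floor_division M ->
  forall n m : M, 0 < m -> exists l : M, forall x, (m * x <= n) = (x < l).
Proof.
move=> H n m m0; have [q /andP[q1 q2]] := H n m m0.
exists (q + 1) => x; apply/idP/idP => [mx|].
  by rewrite -(ltr_pM2l m0); lra.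
by rewrite -leD1 lerD2r -(ler_pM2l m0); lra.
Qed.

(** For [c != 0], the successor of the quotient of [d] or [- d - 1] by [`|c|]
    replaces the possibly missing zero of [c * x + d].  The half-open interval
    reflects that [l] is the first point at which the sign is the new one. *)
Lemma affine_sign_change (M : discOrdRingType) : floor_division M ->
  forall c d : M, exists l : M, forall x y : M, x <= y -> ~~ (x < l <= y) ->
    (0 <= c * x + d) = (0 <= c * y + d).
Proof.
move=> H c d.
have thr (l x y : M) : x <= y -> ~~ (x < l <= y) -> (x < l) = (y < l).
  move=> xy; rewrite negb_and -leNgt -ltNge => /orP[lx|yl].
    by rewrite !ltNge lx (le_trans lx xy).
  by rewrite yl (le_lt_trans xy yl).
case: (ltrgt0P c) => [c0|c0|->].
- have [l Hl] := floor_threshold H (- d - 1) c0.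
  exists l => x y xy xly.
  (* By discreteness, [c * z + d] is negative iff it is at most [- 1]. *)
  have ge0E z : (0 <= c * z + d) = ~~ (z < l).
    rewrite -Hl -ltNge -leD1; apply/idP/idP; lra.
  by rewrite !ge0E (thr _ _ _ xy xly).
- have [|l Hl] := floor_threshold H d (_ : 0 < - c); first by rewrite oppr_gt0.
  exists l => x y xy xly.
  have ge0E z : (0 <= c * z + d) = (z < l).
    by rewrite -Hl; apply/idP/idP; lra.
  by rewrite !ge0E (thr _ _ _ xy xly).
- by exists 0 => x y _ _; rewrite !mul0r.
Qed.

(** * Predicates with finitely many changes of truth value *)

Definition breaks_only_at (M : realDomainType) (L : seq M)
    (P : nonneg M -> Prop) : Prop :=
  forall x y : nonneg M, nonneg_val x <= nonneg_val y ->
    (forall l, l \in L -> ~~ (nonneg_val x < l <= nonneg_val y)) -> P x <-> P y.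

(** A break at [l] inside the range of induction splits it into a part ending at
    [l - 1] and a part starting at [l]; on neither is [l] a break any more, so
    both are handled by the shorter list, and the step from [l - 1] to [l]
    joins them. *)
Lemma breaks_only_at_induction (M : discOrdRingType) (L : seq M)
    (P : nonneg M -> Prop) :
  breaks_only_at L P -> (forall x, P x -> P (x + 1)) -> P 0 -> forall x, P x.
Proof.
move=> stab step P0 b.
suff sweep (K : seq M) (a c : nonneg M) : nonneg_val a <= nonneg_val c ->
    (forall x y : nonneg M, nonneg_val a <= nonneg_val x ->
       nonneg_val x <= nonneg_val y -> nonneg_val y <= nonneg_val c ->
       (forall l, l \in K -> ~~ (nonneg_val x < l <= nonneg_val y)) -> P x -> P y) ->
    P a -> P c.
  apply: (sweep L 0) P0; first exact: (valP b).
  by move=> x y _ xy _ /(stab x y xy)[].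
(* The constancy of [P] is only assumed on [a, c], so that the removal of a
   break outside that range preserves the hypothesis. *)
elim: K a c => [|l K IH] a c ac const Pa; first exact: const Pa.
case: (boolP (nonneg_val a < l <= nonneg_val c)) => [/andP[al lc]|alc]; last first.
  apply: (IH a c) => // x y ax xy yc xKy; apply: const => // k.
  rewrite inE => /predU1P[->|/xKy //]; apply: contra alc => /andP[xl ly].
  by apply/andP; split; lra.
have a0 : 0 <= nonneg_val a := valP a.
have al1 : nonneg_val a <= l - 1 by rewrite lerBrDr leD1.
have l1P : l - 1 \is Num.nneg by rewrite qualifE /=; lra.
have lP : l \is Num.nneg by rewrite qualifE /=; lra.
have Pl1 : P (Nonneg l1P).
  apply: (IH a) => // x y ax xy /= yl xKy; apply: const => //; first by lra.
  by move=> k; rewrite inE => /predU1P[->|/xKy //]; apply/negP; lra.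
have Pl : P (Nonneg lP).
  suff -> : Nonneg lP = Nonneg l1P + 1 by apply: step.
  by apply: val_inj => /=; ring.
apply: (IH (Nonneg lP)) => //= x y lx xy yc xKy; apply: const => //; first by lra.
by move=> k; rewrite inE => /predU1P[->|/xKy //]; apply/negP; lra.
Qed.

Lemma breaks_only_atW (M : realDomainType) (K L : seq M) (P : nonneg M -> Prop) :
  {subset K <= L} -> breaks_only_at K P -> breaks_only_at L P.
Proof. by move=> KL KP x y xy xLy; apply: KP => // l /KL; apply: xLy. Qed.

(** * Linear formulas *)

(** A product in a linear term has a parameter as a factor, so it multiplies an
    affine function of the distinguished variable by a constant. *)
Lemma eval_linear (M : realDomainType) (v : nat -> nonneg M) x t :
  linear_term x t ->
  exists p q : M, forall a : nonneg M,
    nonneg_val (eval (S := nonneg_structure M) [eta v with x |-> a] t) =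
      p * nonneg_val a + q.
Proof.
elim: t => [y|||s IHs t IHt|s IHs t IHt] /=.
- move=> _; case: (y == x); first by exists 1, 0 => a; rewrite mul1r addr0.
  by exists 0, (nonneg_val (v y)) => a; rewrite mul0r add0r.
- by exists 0, 0 => a; rewrite mul0r addr0.
- by exists 0, 1 => a; rewrite mul0r add0r.
- move=> /andP[/IHs[p [q pq]] /IHt[p' [q' pq']]].
  by exists (p + p'), (q + q') => a; rewrite [LHS](congr2 +%R (pq a) (pq' a)); ring.
- move=> /and3P[par /IHs[p [q pq]] /IHt[p' [q' pq']]].
  have paramE r : is_param x r -> exists b : M, forall a : nonneg M,
      nonneg_val (eval (S := nonneg_structure M) [eta v with x |-> a] r) = b.
    by case: r => //= y /negPf yx; exists (nonneg_val (v y)) => a; rewrite yx.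
  case/orP: par => /paramE[b br].
    exists (b * p'), (b * q') => a.
    by rewrite [LHS](congr2 *%R (br a) (pq' a)); ring.
  exists (p * b), (q * b) => a.
  by rewrite [LHS](congr2 *%R (pq a) (br a)); ring.
Qed.

Lemma linear_formula_breaks (M : discOrdRingType) : floor_division M ->
  forall (v : nat -> nonneg M) x p, open_formula p -> linear_formula x p ->
  exists L : seq M, breaks_only_at L
    (fun a => sat (S := nonneg_structure M) [eta v with x |-> a] p).
Proof.
move=> H v x.
have leP s t : linear_term x s -> linear_term x t -> exists l : M,
    breaks_only_at [:: l] (fun a => sat (S := nonneg_structure M)
                                      [eta v with x |-> a] (Le s t)).
  move=> /(eval_linear v)[p [q pq]] /(eval_linear v)[p' [q' pq']].
  have [l Hl] := affine_sign_change H (p' - p) (q' - q).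
  have leE a : sat (S := nonneg_structure M) [eta v with x |-> a] (Le s t) <->
      0 <= (p' - p) * nonneg_val a + (q' - q).
    rewrite [sat _ _]/(is_true (nonneg_val _ <= nonneg_val _)) pq pq'.
    by split; lra.
  by exists l => a b ab alb; rewrite !leE (Hl _ _ ab) // alb ?inE.
have binary (P Q : nonneg M -> Prop) K L : breaks_only_at K P ->
    breaks_only_at L Q -> breaks_only_at (K ++ L) P /\ breaks_only_at (K ++ L) Q.
  by move=> KP LQ; split;
     [apply: breaks_only_atW KP|apply: breaks_only_atW LQ] => l; rewrite mem_cat => ->; rewrite ?orbT.
elim=> [s t|s t|p IH|p IHp q IHq|p IHp q IHq|p IHp q IHq|//|//] /=.
(* An equation is a pair of opposite inequalities. *)
- move=> _ /andP[ls lt]; have [k Hk] := leP s t ls lt; have [l Hl] := leP t s lt ls.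
  exists ([:: k] ++ [:: l]); have [{}Hk {}Hl] := binary _ _ _ _ Hk Hl.
  move=> a b ab aLb; have := Hl a b ab aLb; have := Hk a b ab aLb => /= st ts.
  split=> e; apply: le_anti; apply/andP; split.
  + by apply/st; rewrite e.
  + by apply/ts; rewrite e.
  + by apply/st; rewrite e.
  + by apply/ts; rewrite e.
- by move=> _ /andP[ls lt]; have [l Hl] := leP s t ls lt; exists [:: l].
- by move=> op lp; have [L HL] := IH op lp; exists L => a b ab /(HL a b ab); tauto.
all: move=> /andP[op oq] /andP[lp lq]; have [K HK] := IHp op lp;
  have [L HL] := IHq oq lq; exists (K ++ L);
  have [{}HK {}HL] := binary _ _ _ _ HK HL;
  move=> a b ab aLb; have := HK a b ab aLb; have := HL a b ab aLb; tauto.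
Qed.

Lemma eval_tsubst (S : arith_structure) x u t (v w : nat -> carrier S) :
  (forall y, w y = if y == x then eval v u else v y) ->
  eval v (tsubst x u t) = eval w t.
Proof.
move=> wE; elim: t => //= [y|s -> t ->|s -> t ->] //.
by rewrite wE; case: (y == x).
Qed.

(** The updated valuation [w] is a variable characterised pointwise because the
    substitution of [x + 1] takes place under a valuation that already updates
    [x]: the resulting double update agrees with a single one only pointwise. *)
Lemma sat_fsubst (S : arith_structure) x u p (v w : nat -> carrier S) :
  open_formula p -> (forall y, w y = if y == x then eval v u else v y) ->
  sat v (fsubst x u p) <-> sat w p.
Proof.
move=> + wE; elim: p => //=.
- by move=> s t _; rewrite !(eval_tsubst _ wE).
- by move=> s t _; rewrite !(eval_tsubst _ wE).
- by move=> p IH /IH; tauto.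
all: by move=> p IHp q IHq /andP[/IHp + /IHq]; tauto.
Qed.

(** * Linear induction and floor division *)

Lemma nonneg_models_IOpenLin (M : discOrdRingType) :
  floor_division M -> models (nonneg_structure M) IOpenLin.
Proof.
move=> H _ [_ []|x p op lp] v /=.
- move=> /(congr1 val) /=; have := valP (v 0%N) => /=.
  rewrite qualifE /= => v0 e; have : nonneg_val (v 0%N) + 1 = 0 := e; lra.
- by move=> /(congr1 val) /addIr; apply: val_inj.
- move=> /eqP v0; have v1 : 1 <= nonneg_val (v 0%N).
    by apply: gt0_ge1; rewrite lt_def v0; apply: (valP (v 0%N)).
  have v1P : nonneg_val (v 0%N) - 1 \is Num.nneg by rewrite qualifE /=; lra.
  by exists (Nonneg v1P); apply: val_inj => /=; ring.
- exact: addr0.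
- exact: addrA.
- exact: mulr0.
- by rewrite mulrDr mulr1.
- split=> [v01|[z <-]].
    have v01' : nonneg_val (v 0%N) <= nonneg_val (v 1%N) := v01.
    have dP : nonneg_val (v 1%N) - nonneg_val (v 0%N) \is Num.nneg.
      by rewrite qualifE /=; lra.
    by exists (Nonneg dP); apply: val_inj => /=; ring.
  have z0 : 0 <= nonneg_val z := valP z.
  by rewrite -[_ <= _]/(nonneg_val (v 0%N) <= nonneg_val z + nonneg_val (v 0%N)); lra.
- move=> [p0 pS]; have [L HL] := linear_formula_breaks H v op lp.
  apply: (breaks_only_at_induction HL) => [a pa|].
    apply: (iffLR (sat_fsubst op _) (pS a pa)) => y /=.
    by rewrite eqxx; case: ifP.
  by apply: (iffLR (sat_fsubst op _) p0) => y /=; case: ifP.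
Qed.

(** Were there no quotient, [m * x <= n] would pass from every [x] to [x + 1],
    and linear induction would carry it up to [x = n + 1]. *)
Lemma floor_division_of_IOpenLin (M : discOrdRingType) :
  models (nonneg_structure M) IOpenLin -> floor_division M.
Proof.
move=> H; apply: floor_division_nonneg => n m n0 m0.
have nP : n \is Num.nneg by rewrite qualifE.
have mP : m \is Num.nneg by rewrite qualifE /= ltW.
(* In [p], variable 0 is the induction variable, 1 is [m] and 2 is [n]. *)
pose v : nat -> nonneg M := nth 0 [:: 0; Nonneg mP; Nonneg nP].
pose p : formula := Le (Mul (Var 1) (Var 0)) (Var 2).
have /= ind := H _ (@IOpenLin_induct 0 p isT isT) v.
apply: NNPP => no_q.
suff le_n (a : nonneg M) : m * nonneg_val a <= n.
  have m1 := gt0_ge1 _ m0; have : m * (n + 1) <= n := le_n (Nonneg nP + 1).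
  have : 0 <= (m - 1) * (n + 1) by rewrite mulr_ge0; lra.
  lra.
apply: ind; split; first by rewrite mulr0; apply: n0.
move=> b mb; have {}mb : m * nonneg_val b <= n := mb.
change (m * (nonneg_val b + 1) <= n); rewrite leNgt; apply/negP => nb.
by apply: no_q; exists (nonneg_val b); rewrite mb nb.
Qed.

Theorem theorem3 (M : discOrdRingType) :
  [<-> (*1*) integer_part (fun r : {fraction M} => exists m : M, r = m%:F);
       (*2*) forall m' m : M, 0 < m ->
               exists i : M, int_part_of (i%:F : {fraction M}) (m'%:F / m%:F);
       (*3*) IPRs (fun f : M -> M => exists m : M, f = (fun x => m * x));
       (*3 star*) forall n k : nonneg M, k != 0 ->
               exists n' l : nonneg M, ((0 : nonneg M) <= l < k)%O /\ n = n' * k + l;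
       (*4*) models (nonneg_structure M) IOpenLin].
Proof.
tfae.
- by move=> [_ fl] m' m m0; have [_ [i ->] ir] := fl (m'%:F / m%:F); exists i.
- move=> H _ [m ->] a b y ab /andP[may ymb].
  have m0 : 0 < m.
    rewrite -(@pmulr_lgt0 _ (b - a)) ?subr_gt0 // mulrBr subr_gt0.
    exact: le_lt_trans ymb.
  have [i] := H y m m0; rewrite int_part_fracE // => /andP[iy yi].
  exists i; rewrite iy yi; split=> //; apply/andP; split.
    by rewrite -(lerD2r 1) leD1 -(ltr_pM2l m0); lra.
  by rewrite -(ltr_pM2l m0); lra.
- move=> H n k k0.
  have n0 : 0 <= nonneg_val n := valP n.
  have kgt0 : 0 < nonneg_val k by rewrite lt_def k0; apply: (valP k).
  have k1 := gt0_ge1 _ kgt0.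
  have [||x [/andP[x0 _] /andP[xn nx]]] :=
      H _ (ex_intro _ (nonneg_val k) erefl) 0 (nonneg_val n + 1) (nonneg_val n).
  + lra.
  + rewrite mulr0 n0 /=.
    have : 0 <= (nonneg_val k - 1) * (nonneg_val n + 1) by rewrite mulr_ge0; lra.
    lra.
  have xP : x \is Num.nneg by [].
  have lP : nonneg_val n - nonneg_val k * x \is Num.nneg by rewrite qualifE /=; lra.
  exists (Nonneg xP), (Nonneg lP); split; last by apply: val_inj => /=; ring.
  rewrite -[X in is_true X]/((0 <= nonneg_val n - nonneg_val k * x) &&
                             (nonneg_val n - nonneg_val k * x < nonneg_val k)).
  by apply/andP; split; lra.
- move=> H; apply: nonneg_models_IOpenLin.
  apply: floor_division_nonneg => n m n0 m0.
  have nP : n \is Num.nneg by rewrite qualifE.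
  have mP : m \is Num.nneg by rewrite qualifE /= ltW.
  have [|q [l [/andP[l0 lk] /(congr1 val) e]]] := H (Nonneg nP) (Nonneg mP).
    by rewrite -val_eqE /= gt_eqF.
  have {}l0 : 0 <= nonneg_val l := l0.
  have {}lk : nonneg_val l < m := lk.
  have {}e : n = nonneg_val q * m + nonneg_val l := e.
  by exists (nonneg_val q); apply/andP; split; lra.
- move=> /floor_division_of_IOpenLin H; split.
    split.
    + by exists 1; rewrite tofrac1.
    + by move=> _ _ [a ->] [b ->]; exists (a - b); rewrite tofracB.
    + by move=> _ _ [a ->] [b ->]; exists (a * b); rewrite tofracM.
    + by move=> _ [a ->]; rewrite -tofrac0 -tofrac1 ltr_tofrac ler_tofrac;
         apply: gt0_ge1.
  move=> r; have [n [m [m0 ->]]] := fracP r; have [q Hq] := H n m m0.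
  by exists q%:F; [exists q|rewrite int_part_fracE].
Qed.
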